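(* (1) For any $\varepsilon_{\mathtt{RM}}\in(0,\tfrac14]$ and $N\gtrsim1$, there exist a problem instance $(\pi_{\mathsf{ref}},\hat r,r^\star)$ with $\varepsilon_{\mathtt{RM}}(x)\le\varepsilon_{\mathtt{RM}}$ and a comparator policy $\pi^\star$ with $\mathcal C^{\pi^\star}(x)=\widetilde O(1)$ such that, for any $x\in\mathcal X$, Best-of-$N$ alignment has regret $$J(\pi^\star;x)-J(\hat\pi_{\mathtt{BoN}};x)\ \ge\ \widetilde\Omega\Big(\sqrt{N\cdot\varepsilon_{\mathtt{RM}}^2}\Big).$$ (2) Further, for any such $\varepsilon_{\mathtt{RM}}$ and for all $N\in\mathbb N$, there exist a problem instance with $\varepsilon_{\mathtt{RM}}(x)\le\varepsilon_{\mathtt{RM}}$ and a comparator policy $\pi^\star$ with $\mathcal C^{\pi^\star}(x)=\widetilde O(1)$ such that, for any $x\in\mathcal X$, Best-of-$N$ alignment has regret $$J(\pi^\star;x)-J(\hat\pi_{\mathtt{BoN}};x)\ \ge\ \widetilde\Omega\Big(\varepsilon_{\mathtt{RM}}^{2/3}\Big).$$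
   Context: A problem instance is a tuple $(\pi_{\mathsf{ref}},\hat r,r^\star)$ of a base policy $\pi_{\mathsf{ref}}:\mathcal X\to\Delta(\mathcal Y)$, a reward model $\hat r$ and a true reward function $r^\star$, both functions $\mathcal X\times\mathcal Y\to[0,R_{\max}]$ with $R_{\max}\ge1$, where $\mathcal X$ is a prompt space and $\mathcal Y$ a response space. A policy is a map $\pi:\mathcal X\to\Delta(\mathcal Y)$. Write $J(\pi;x)=\mathbb E_{y\sim\pi(\cdot\mid x)}[r^\star(x,y)]$, $\varepsilon_{\mathtt{RM}}^2(x)=\mathbb E_{y\sim\pi_{\mathsf{ref}}(\cdot\mid x)}[(\hat r(x,y)-r^\star(x,y))^2]$, and $\mathcal C^{\pi}(x)=\mathbb E_{y\sim\pi(\cdot\mid x)}\big[\frac{\pi(y\mid x)}{\pi_{\mathsf{ref}}(y\mid x)}\big]$. Best-of-$N$ alignment: given $x$, draw $y_1,\dots,y_N$ i.i.d. from $\pi_{\mathsf{ref}}(\cdot\mid x)$ and return $y_{i^\star}$ with $i^\star\in\arg\max_{i\in[N]}\hat r(x,y_i)$; $\hat\pi_{\mathtt{BoN}}(\cdot\mid x)$ is the distribution of the returned response. Notation: $f\lesssim g$ means $f=O(g)$ (so $N\gtrsim1$ means $N$ is at least an absolute constant); $f=\widetilde O(g)$ means $f=O(g\cdot\max\{1,\mathrm{polylog}(g)\})$, and $\widetilde\Omega$ is the corresponding lower-bound notation.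
   Formalization: Part (1) is proved for every R_max ≥ 1 with sqrt(N·ε_RM²) ≤ R_max; for a fixed R_max the claim fails as N → ∞, since the regret never exceeds R_max while the lower bound is unbounded. *)

(* Defs.v *)
From HB Require Import structures.
From mathcomp Require Import all_boot all_order all_algebra.
From mathcomp Require Import all_classical all_reals all_analysis.

Set Implicit Arguments.
Unset Strict Implicit.
Unset Printing Implicit Defensive.

Import Order.TTheory GRing.Theory Num.Theory.
Local Open Scope ring_scope.

Record fdist (R : realType) (Y : finType) := FDist {
  pmf :> Y -> R;
  pmf_ge0 : forall y, 0 <= pmf y;
  pmf_sum1 : \sum_y pmf y = 1 }.

Definition expect (R : realType) (Y : finType) (p : fdist R Y) (f : Y -> R) : R :=
  \sum_y p y * f y.

Section Pushforward.
Variables (R : realType) (T Y : finType) (f : T -> Y) (p : fdist R T).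

Definition fdist_map_pmf (y : Y) : R := \sum_(t | f t == y) p t.

Lemma fdist_map_ge0 y : 0 <= fdist_map_pmf y.
Proof. by apply: sumr_ge0 => t _; apply: pmf_ge0. Qed.

Lemma fdist_map_sum1 : \sum_y fdist_map_pmf y = 1.
Proof.
rewrite -(pmf_sum1 p) (partition_big f xpredT) //=.
Qed.

Definition fdist_map : fdist R Y := FDist fdist_map_ge0 fdist_map_sum1.

End Pushforward.

Section IID.
Variables (R : realType) (Y : finType) (N : nat) (p : fdist R Y).

Definition fdist_iid_pmf (t : {ffun 'I_N -> Y}) : R := \prod_(i < N) p (t i).

Lemma fdist_iid_ge0 t : 0 <= fdist_iid_pmf t.
Proof. by apply: prodr_ge0 => i _; apply: pmf_ge0. Qed.

Lemma fdist_iid_sum1 : \sum_t fdist_iid_pmf t = 1.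
Proof.
rewrite /fdist_iid_pmf -(bigA_distr_bigA (fun (_ : 'I_N) y => p y)) /=.
by apply: big1 => i _; apply: pmf_sum1.
Qed.

Definition fdist_iid : fdist R {ffun 'I_N -> Y} := FDist fdist_iid_ge0 fdist_iid_sum1.

End IID.

Definition policy (R : realType) (X : Type) (Y : finType) := X -> fdist R Y.

Record instance (R : realType) (X : Type) (Y : finType) (Rmax : R) := Instance {
  pi_ref : policy R X Y;
  rhat : X -> Y -> R;
  rstar : X -> Y -> R;
  rhat_range : forall x y, 0 <= rhat x y <= Rmax;
  rstar_range : forall x y, 0 <= rstar x y <= Rmax }.

Section Quantities.
Variables (R : realType) (X : Type) (Y : finType) (Rmax : R).
Variable I : instance X Y Rmax.

Definition J (pi : policy R X Y) (x : X) : R := expect (pi x) (rstar I x).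

Definition eps_RM (x : X) : R :=
  Num.sqrt (expect (pi_ref I x) (fun y => (rhat I x y - rstar I x y) ^+ 2)).

(* In \bar R, 0^-1 = +oo and 0 * +oo = 0: responses with pi y = 0 contribute 0,
   and the coverage is +oo unless pi is absolutely continuous w.r.t. pi_ref. *)
Definition coverage (pi : policy R X Y) (x : X) : \bar R :=
  (\sum_(y : Y) (pi x y)%:E * ((pi x y)%:E / (pi_ref I x y)%:E))%E.

(* [sel x t] is the index i* chosen from the sample t = (y_1, ..., y_N);
   the tie-breaking among maximizers of rhat is arbitrary. *)
Definition argmax_rule (N : nat) (sel : X -> {ffun 'I_N -> Y} -> 'I_N) : Prop :=
  forall (x : X) (t : {ffun 'I_N -> Y}) (i : 'I_N),
    rhat I x (t i) <= rhat I x (t (sel x t)).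

Definition BoN (N : nat) (sel : X -> {ffun 'I_N -> Y} -> 'I_N) : policy R X Y :=
  fun x => fdist_map (fun t : {ffun 'I_N -> Y} => t (sel x t))
                     (fdist_iid N (pi_ref I x)).

End Quantities.

(* f = tilde-O(g) (resp. tilde-Omega(g)) means that f <= tildeO C k g (resp.
   f >= tildeOmega C k g) for constants C > 0 and k independent of all
   parameters; powers of |ln g| are cofinal among polylogarithms of g. *)
Definition tildeO (R : realType) (C : R) (k : nat) (g : R) : R :=
  C * (g * Num.max 1 (`|ln g| ^+ k)).

Definition tildeOmega (R : realType) (C : R) (k : nat) (g : R) : R :=
  C * (g / Num.max 1 (`|ln g| ^+ k)).

(* Main.v *)
(** Two responses suffice.  Let [true] have reference mass [p] and the larger
estimated reward, so that Best-of-N returns [false] with probability exactly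
[(1 - p) ^+ N], whatever the tie-breaking.

Overoptimization: if [rhat] overestimates [true] by [s] with [p * s ^+ 2 <=
eps ^+ 2] and [1 <= N * p], Best-of-N returns the worthless [true] with
probability at least [1/2] and loses [s / 4] against always answering [false].
Part (1) takes [p = 1 / N] and [s = sqrt (N * eps ^+ 2)].  Part (2) for
[1 <= N * eps `^ (2/3)] takes [p = s = eps `^ (2/3)].

Undersampling: with exact rewards [1] on [true] and [0] on [false] and
[p = (2N)^-2], the comparator putting mass [sqrt p = 1 / (2N)] on [true] has
bounded coverage, while Best-of-N finds [true] with probability at most
[N * p = 1 / (4N)]; this covers the remaining case [N * eps `^ (2/3) < 1]. *)

Require Import Defs.
From mathcomp Require Import all_boot all_order all_algebra.
From mathcomp Require Import all_classical all_reals all_analysis.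
From mathcomp Require Import ring lra.

Import Order.TTheory GRing.Theory Num.Theory.
Local Open Scope ring_scope.

Section TwoPoint.
Context {R : realType}.

Definition two_point_pmf (p : R) (b : bool) : R := if b then p else 1 - p.

Lemma two_point_ge0 (p : R) : 0 <= p <= 1 -> forall b, 0 <= two_point_pmf p b.
Proof. by move=> /andP[p0 p1] [] //=; rewrite subr_ge0. Qed.

Lemma two_point_sum1 (p : R) : \sum_b two_point_pmf p b = 1.
Proof. by rewrite big_bool /= addrC subrK. Qed.

Definition two_point (p : R) (hp : 0 <= p <= 1) : fdist R bool :=
  FDist (two_point_ge0 p hp) (two_point_sum1 p).

Lemma fdist_bool_true (d : fdist R bool) : d true = 1 - d false.
Proof. by rewrite -(pmf_sum1 d) big_bool /= addrK. Qed.

Context {X : Type} {Rmax : R}.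
Implicit Types I : instance X bool Rmax.

(** A single [true] in the sample forces the argmax onto [true], so only the constant [false] sample
    returns [false]. *)
Lemma BoN_false I (N : nat) (sel : X -> {ffun 'I_N -> bool} -> 'I_N) (x : X) :
  argmax_rule I sel -> rhat I x false < rhat I x true ->
  BoN I sel x false = pi_ref I x false ^+ N.
Proof.
move=> selP lt_r; rewrite /= /fdist_map_pmf (big_pred1 [ffun=> false]) /=.
  rewrite /fdist_iid_pmf (eq_bigr (fun=> pi_ref I x false)).
    by rewrite prodr_const card_ord.
  by move=> i _; rewrite ffunE.
move=> t /=; apply/eqP/eqP => [t_sel|->]; last by rewrite ffunE.
apply/ffunP => i; rewrite ffunE; case ti: (t i) => //.
by have := selP x t i; rewrite ti t_sel leNgt lt_r.
Qed.

Lemma J_sub I (pi pi' : policy R X bool) (x : X) :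
  J I pi x - J I pi' x =
  (pi x false - pi' x false) * (rstar I x false - rstar I x true).
Proof. by rewrite /J /expect !big_bool /= !fdist_bool_true; ring. Qed.

(** Nonzero reference masses keep both inverses in [\bar R] finite, so the coverage is a real
    number. *)
Lemma coverage_bool I (pi : policy R X bool) (x : X) :
  pi_ref I x true != 0 -> pi_ref I x false != 0 ->
  coverage I pi x = (pi x true ^+ 2 / pi_ref I x true +
                     pi x false ^+ 2 / pi_ref I x false)%:E.
Proof.
move=> t0 f0; rewrite /coverage big_bool /= !inver (negbTE t0) (negbTE f0).
by rewrite -!EFinM -EFinD !mulrA -!expr2.
Qed.

End TwoPoint.

(** Bernoulli gives [(1 + p) ^+ N >= 1 + N * p >= 2], while [(1 - p) ^+ N * (1 + p) ^+ N = (1 - p ^+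
    2) ^+ N <= 1]. *)
Lemma expr_one_sub_le_half {R : realFieldType} (p : R) (N : nat) :
  0 <= p <= 1 -> 1 <= N%:R * p -> (1 - p) ^+ N <= 1 / 2.
Proof.
move=> /andP[p0 p1] Np.
have bern : 2 <= (1 + p) ^+ N.
  apply: (@le_trans _ _ (1 + N%:R * p)); first by lra.
  elim: N {Np} => [|n IHn]; first by rewrite mul0r addr0 expr0.
  rewrite exprS; apply: le_trans (ler_wpM2l _ IHn); last by lra.
  have : 0 <= n%:R * p * p by rewrite !mulr_ge0.
  by rewrite -natr1; lra.
have h : (1 - p) ^+ N * (1 + p) ^+ N <= 1.
  by rewrite -exprMn exprn_ile1 //; nra.
have h0 : 0 <= (1 - p) ^+ N by rewrite exprn_ge0 // subr_ge0.
by have := ler_wpM2l h0 bern; lra.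
Qed.

Lemma bernoulli_one_sub {R : realFieldType} (p : R) (N : nat) :
  0 <= p <= 1 -> 1 - N%:R * p <= (1 - p) ^+ N.
Proof.
move=> /andP[p0 p1]; elim: N => [|n IHn]; first by rewrite mul0r subr0 expr0.
rewrite exprS; apply: le_trans (ler_wpM2l _ IHn); last by lra.
have : 0 <= n%:R * p * p by rewrite !mulr_ge0.
by rewrite -natr1; lra.
Qed.

Lemma overoptimization_instance (R : realType) (X : Type) (Rmax eps p s : R)
    (N : nat) :
  0 <= eps -> 0 < p <= 1 / 2 -> 0 < s <= Rmax -> p * s ^+ 2 <= eps ^+ 2 ->
  1 <= N%:R * p ->
  exists (Y : finType) (I : instance X Y Rmax) (pistar : policy R X Y),
    [/\ forall x : X, eps_RM I x <= eps,
        forall x : X, (coverage I pistar x <= 3%:E)%E &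
        forall sel : X -> {ffun 'I_N -> Y} -> 'I_N, argmax_rule I sel ->
        forall x : X, s / 4 <= J I pistar x - J I (BoN I sel) x].
Proof.
move=> eps0 /andP[p0 p12] /andP[s0 sR] ps Np.
have hp : 0 <= p <= 1 by apply/andP; split; lra.
have h0 : 0 <= (0 : R) <= 1 by rewrite lexx ler01.
(* The two rewards differ only on [true], so the mean squared error is exactly [p * s ^+ 2]; the
   value [s / 2] on [false] makes [true] the strict maximizer of [rh]. *)
pose rh (_ : X) b := if b then s else s / 2.
pose rs (_ : X) b := if b then 0 else s / 2.
have rh_range x y : 0 <= rh x y <= Rmax by case: y => /=; apply/andP; split; lra.
have rs_range x y : 0 <= rs x y <= Rmax by case: y => /=; apply/andP; split; lra.
pose I := Instance (fun=> two_point p hp) rh_range rs_range.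
exists bool, I, (fun=> two_point 0 h0); split.
- move=> x; rewrite /eps_RM /expect big_bool /= !subr0 subrr expr0n mulr0 addr0.
  by rewrite -(ger0_norm eps0) -sqrtr_sqr ler_wsqrtr.
- move=> x; rewrite coverage_bool /=; [|lra|lra].
  rewrite lee_fin expr0n mul0r add0r subr0 expr1n div1r.
  by rewrite invf_ple ?posrE; lra.
(* The regret is [(1 - (1 - p) ^+ N) * (s / 2)], and the first factor is at least [1 / 2]. *)
- move=> sel selP x; rewrite J_sub BoN_false //=; last by rewrite /rh; lra.
  rewrite /rs /=; have := expr_one_sub_le_half p N hp Np; nra.
Qed.

Lemma undersampling_instance (R : realType) (X : Type) (Rmax eps : R) (N : nat) :
  1 <= Rmax -> 0 <= eps -> (0 < N)%N ->
  exists (Y : finType) (I : instance X Y Rmax) (pistar : policy R X Y),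
    [/\ forall x : X, eps_RM I x <= eps,
        forall x : X, (coverage I pistar x <= 3%:E)%E &
        forall sel : X -> {ffun 'I_N -> Y} -> 'I_N, argmax_rule I sel ->
        forall x : X, N%:R^-1 / 4 <= J I pistar x - J I (BoN I sel) x].
Proof.
move=> R1 eps0 N0.
have Npos : 0 < N%:R :> R by rewrite ltr0n.
(* [q] is the comparator's mass on [true] and [q ^+ 2] the reference mass, so [true] contributes
   exactly 1 to the coverage. *)
pose q : R := N%:R^-1 / 2.
have q0 : 0 < q by rewrite divr_gt0 ?invr_gt0.
have q12 : q <= 1 / 2.
  by rewrite ler_pM2r ?invr_gt0 // invf_ple ?posrE // invr1 ler1n.
have hq : 0 <= q <= 1 by apply/andP; split; lra.
have q2_gt0 : 0 < q ^+ 2 by rewrite exprn_gt0.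
have q2_le : q ^+ 2 <= 1 / 4 by rewrite expr2; nra.
have hp : 0 <= q ^+ 2 <= 1 by apply/andP; split; lra.
pose r (_ : X) (b : bool) : R := if b then 1 else 0.
have r_range x y : 0 <= r x y <= Rmax by case: y => /=; apply/andP; split; lra.
pose I := Instance (fun=> two_point (q ^+ 2) hp) r_range r_range.
exists bool, I, (fun=> two_point q hq); split.
- by move=> x; rewrite /eps_RM /expect big_bool /= !subrr expr0n !mulr0 addr0 sqrtr0.
- move=> x; rewrite coverage_bool /=; [|lra|lra].
  rewrite lee_fin divff; last by lra.
  have : (1 - q) ^+ 2 / (1 - q ^+ 2) <= 2.
    by rewrite ler_pdivrMr; [rewrite expr2; nra|lra].
  lra.
- move=> sel selP x; rewrite J_sub BoN_false //=.
  (* Best-of-N has mass at most [N * q ^+ 2 = q / 2] on [true], which leaves a gap of at least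
     [q / 2] to the comparator. *)
  have Nq : N%:R * q ^+ 2 = q / 2 by rewrite /q; field; rewrite gt_eqF.
  have := bernoulli_one_sub (q ^+ 2) N hp; rewrite Nq /r.
  have -> : N%:R^-1 / 4 = q / 2 by rewrite /q; field; rewrite gt_eqF.
  lra.
Qed.

Lemma tildeO_0 (R : realType) (C : R) : tildeO C 0 1 = C.
Proof. by rewrite /tildeO expr0 maxxx !mulr1. Qed.

Lemma tildeOmega_0 (R : realType) (C g : R) : tildeOmega C 0 g = C * g.
Proof. by rewrite /tildeOmega expr0 maxxx divr1. Qed.

Theorem theorem3p2 (R : realType) :
  (exists (N0 j k : nat) (C c : R), 0 < C /\ 0 < c /\
    forall (X : Type) (Rmax eps : R) (N : nat),
      1 <= Rmax -> 0 < eps <= 1 / 4 -> (N0 <= N)%N ->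
      Num.sqrt (N%:R * eps ^+ 2) <= Rmax ->
      exists (Y : finType) (I : instance X Y Rmax) (pistar : policy R X Y),
        [/\ forall x : X, eps_RM I x <= eps,
            forall x : X, (coverage I pistar x <= (tildeO C j 1)%:E)%E &
            forall sel : X -> {ffun 'I_N -> Y} -> 'I_N, argmax_rule I sel ->
            forall x : X,
              J I pistar x - J I (BoN I sel) x
                >= tildeOmega c k (Num.sqrt (N%:R * eps ^+ 2))]) /\
  (exists (j k : nat) (C c : R), 0 < C /\ 0 < c /\
    forall (X : Type) (Rmax eps : R) (N : nat),
      1 <= Rmax -> 0 < eps <= 1 / 4 -> (0 < N)%N ->
      exists (Y : finType) (I : instance X Y Rmax) (pistar : policy R X Y),
        [/\ forall x : X, eps_RM I x <= eps,
            forall x : X, (coverage I pistar x <= (tildeO C j 1)%:E)%E &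
            forall sel : X -> {ffun 'I_N -> Y} -> 'I_N, argmax_rule I sel ->
            forall x : X,
              J I pistar x - J I (BoN I sel) x
                >= tildeOmega c k (eps `^ (2 / 3))]).
Proof.
split.
  (* [N >= 2] ensures [p = 1 / N <= 1 / 2]; exponent 0 means that no logarithmic factor is lost. *)
  exists 2%N, 0%N, 0%N, 3, 4^-1; do 2![split; first by []].
  move=> X Rmax eps N R1 /andP[eps0 _] N2 sR.
  have N0 : 0 < N%:R :> R by rewrite ltr0n (leq_trans _ N2).
  have [|||||Y [I [pistar [h1 h2 h3]]]] := @overoptimization_instance R X Rmax
    eps N%:R^-1 (Num.sqrt (N%:R * eps ^+ 2)) N.
  - exact: ltW.
  - by rewrite invr_gt0 N0 div1r lef_pV2 ?posrE // ler_nat.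
  - by rewrite sqrtr_gt0 mulr_gt0 ?exprn_gt0.
  - by rewrite sqr_sqrtr ?mulKf ?gt_eqF // mulr_ge0 ?sqr_ge0.
  - by rewrite mulfV ?gt_eqF.
  exists Y, I, pistar; split=> // [x|sel selP x]; first by rewrite tildeO_0.
  by rewrite tildeOmega_0 mulrC h3.
exists 0%N, 0%N, 3, 4^-1; do 2![split; first by []].
move=> X Rmax eps N R1 /andP[eps0 eps4] N0.
set D := eps `^ (2 / 3).
have D0 : 0 < D by rewrite powR_gt0.
have D3 : D * D ^+ 2 = eps ^+ 2.
  rewrite -exprS -!powR_mulrn ?(ltW eps0) ?(ltW D0) // -powRrM.
  by congr (_ `^ _); field.
(* Otherwise [D ^+ 3 > 1 / 8], against [D ^+ 3 = eps ^+ 2 <= 1 / 16]. *)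
have D12 : D <= 1 / 2.
  rewrite leNgt; apply/negP => D_gt.
  have : eps ^+ 2 <= 1 / 16 by nra.
  have D2 : 1 / 4 < D ^+ 2 by nra.
  by rewrite -D3; nra.
have [ND|ND] := leP 1 (N%:R * D).
  have [|||||Y [I [pistar [h1 h2 h3]]]] :=
    @overoptimization_instance R X Rmax eps D D N.
  - exact: ltW.
  - by rewrite D0.
  - by rewrite D0; lra.
  - by rewrite D3.
  - by [].
  exists Y, I, pistar; split=> // [x|sel selP x]; first by rewrite tildeO_0.
  by rewrite tildeOmega_0 mulrC h3.
have [Y [I [pistar [h1 h2 h3]]]] :=
  @undersampling_instance R X Rmax eps N R1 (ltW eps0) N0.
exists Y, I, pistar; split=> // [x|sel selP x]; first by rewrite tildeO_0.
(* Here [N * D < 1], so [D / 4] is below the undersampling loss [1 / (4N)]. *)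
rewrite tildeOmega_0 mulrC; apply: le_trans (h3 _ selP x).
rewrite ler_pM2r ?invr_gt0 // -[_^-1]div1r ler_pdivlMr ?ltr0n // mulrC.
exact: ltW.
Qed.
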